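(* Let $k\ge 2$ be a fixed integer. Then, as $x\to\infty$, $$\sum_{n\le x} \varphi_k(n)= \frac{C_k}{k+1}x^{k+1} +O\left(x^k (\log x)^{k+1}\right),$$ where $$C_k= \prod_p \left(1+\frac1{p^{k+1}}\left(\left(1-\frac1{p}\right)\left((p-1)^k-(-1)^k\right)-p^k \right) \right),$$ the product being over all primes $p$.
   Context: $(a,b)$ denotes the greatest common divisor. For positive integers $k,n$, $\varphi_k(n)$ denotes the number of ordered $k$-tuples of integers $(a_1,\ldots,a_k)$ with $1\le a_1,\ldots,a_k\le n$ such that $(a_1\cdots a_k,n)=1$ and $(a_1+\cdots+a_k,n)=1$. The sum is over positive integers $n\le x$, with $x$ real, and the constant implied by the $O$-symbol may depend on the fixed $k$. *)

(* Defs.v *)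
From mathcomp Require Import all_boot all_order all_algebra.
From mathcomp Require Import all_classical all_reals all_analysis.

Set Implicit Arguments.
Unset Strict Implicit.
Unset Printing Implicit Defensive.

Import Order.TTheory GRing.Theory Num.Theory.
Import numFieldNormedType.Exports.

Local Open Scope ring_scope.

(* The type ['I_n.+1] is {0, ..., n}, so the condition [0 < tnth a i] leaves
   exactly the k-tuples with entries in {1, ..., n}. *)
Definition phi_k (k n : nat) : nat :=
  #|[set a : k.-tuple 'I_n.+1 |
      [&& [forall i : 'I_k, 0 < tnth a i]%N,
          coprime (\prod_(i < k) tnth a i)%N n
        & coprime (\sum_(i < k) tnth a i)%N n]]%SET|.

Definition euler_factor (R : realType) (k p : nat) : R :=
  1 + 1 / p%:R ^+ k.+1 *
      ((1 - 1 / p%:R) * ((p%:R - 1) ^+ k - (-1) ^+ k) - p%:R ^+ k).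

Definition euler_partial_prod (R : realType) (k : nat) : R^nat :=
  fun N => \prod_(0 <= p < N | prime p) euler_factor R k p.

(* [limn] is only meaningful for a convergent sequence; convergence has to be
   asserted separately. *)
Definition C_ (R : realType) (k : nat) : R := limn (euler_partial_prod R k).

(* Lets the Landau notations be used along the filter x --> +oo. *)
Canonical pinfty_filter_on (R : numFieldType) :=
  FilterType (pinfty_nbhs R) (@filter_filter R _ proper_pinfty_nbhs).

(* Main.v *)
Require Import Defs.
From mathcomp Require Import all_boot all_order all_algebra.
From mathcomp Require Import all_classical all_reals all_analysis.
From mathcomp Require Import zify ring lra.

(** The Chinese remainder theorem makes the density [phi_k k n / n ^ k] a product over
    the primes dividing [n] ([phi_kE]). The factor at [p] is the proportion of
    [k]-tuples of nonzero residues modulo [p] with nonzero sum; fixing all entries but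
    one yields a recursion on [k], hence the closed form [local_density] and the bound
    [`|local_density k p - 1| <= (k + 1) / p].

    Put [g p = local_density k p - 1], and let [h d = \prod_(p | d) g p] for squarefree
    [d], and [h d = 0] otherwise. Then [phi_k k n / n ^ k] is the sum of [h d] over the
    divisors [d] of [n] ([sqf_prod_sum_divisors]). Exchanging the summations and using
    [\sum_(j <= y) j ^ k = y ^ (k + 1) / (k + 1) + O(y ^ k)] with [y = x / d], the
    summatory function of [phi_k] becomes
    [x ^ (k + 1) / (k + 1) * \sum_(d <= x) h d / d + O(x ^ k * \sum_(d <= x) `|h d|)].
    The series of the [h d / d] is the expansion of the Euler product defining [C_ k],
    since the Euler factor at [p] is [1 + g p / p] ([euler_factorE]).

    It remains to bound the sum of [`|h d|] over [d <= x] and the tail of the series.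
    Both follow from [`|h d| <= m ^ omega(d) / d], where [m = k + 1], by Rankin's trick:
    for [0 < e <= 1], inserting [(x / d) ^ e] or [(d / x) ^ (1 - e)] reduces them to
    the sum of [m ^ omega(d) / d ^ (1 + e)] over squarefree [d], which is at most
    [zeta (1 + e) ^ m <= (1 + 1 / e) ^ m] ([sum_sqf_prod_le], [zeta_partial_sum_le]).
    With [e = 1 / ln x] this gives the error term [x ^ k * ln x ^ (k + 1)]; with
    [e = 1 / 2] it gives the convergence of the Euler product. *)

Import Order.TTheory GRing.Theory Num.Theory.
Import numFieldNormedType.Exports.

Local Open Scope classical_set_scope.
Local Open Scope ring_scope.

Set Implicit Arguments.
Unset Strict Implicit.
Unset Printing Implicit Defensive.

(** * Multiplicative functions supported on squarefree integers *)

(** Building an integer one prime factor at a time lets multiplicative identities be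
    proved by telling apart only whether the new prime already divides. *)
Lemma prime_mul_ind (P : nat -> Prop) :
  P 1%N -> (forall p m, prime p -> (0 < m)%N -> P m -> P (p * m)%N) ->
  forall n, (0 < n)%N -> P n.
Proof.
move=> P1 PM; elim/ltn_ind => n IH n0.
have [n1|n1] := leqP n 1; first by have -> : n = 1%N by lia.
have pp := pdiv_prime n1; have := pdiv_dvd n.
move: (pdiv n) pp => p pp /dvdnP[m E]; move: IH n0; rewrite E mulnC => IH.
rewrite muln_gt0 => /andP[p0 m0]; apply: PM => //; apply: IH => //.
by rewrite -[ltnLHS]mul1n ltn_pmul2r ?prime_gt1.
Qed.

Definition squarefree (d : nat) : bool := all (fun p => logn p d == 1%N) (primes d).

(** With [g] replaced by [f - 1], this is the Moebius transform of the function
    [n |-> \prod_(p | n) f p], and with [g] constant equal to [m] it is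
    [mu ^ 2 * m ^ omega]. *)
Definition sqf_prod (A : pzSemiRingType) (g : nat -> A) (d : nat) : A :=
  if squarefree d then \prod_(p <- primes d) g p else 0.

Lemma sqf_prod1 (A : pzSemiRingType) (g : nat -> A) : sqf_prod g 1 = 1.
Proof. by rewrite /sqf_prod /squarefree /= big_nil. Qed.

Lemma primes_mul_prime p d : prime p -> (0 < d)%N -> ~~ (p %| d)%N ->
  perm_eq (primes (p * d)) (p :: primes d).
Proof.
move=> pp d0 pd; apply: uniq_perm; rewrite ?primes_uniq //=.
  by rewrite primes_uniq andbT mem_primes pp d0 (negPf pd).
by move=> q; rewrite primesM ?(prime_gt0 pp)// primes_prime// !inE.
Qed.

Lemma primes_mul_dvd p d : prime p -> (0 < d)%N -> (p %| d)%N ->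
  primes (p * d) = primes d.
Proof.
move=> pp d0 pd.
apply: (irr_sorted_eq ltn_trans ltnn); rewrite ?sorted_primes// => q.
rewrite primesM ?(prime_gt0 pp)// primes_prime// inE.
by case: eqP => // ->; rewrite mem_primes pp d0 pd.
Qed.

Lemma squarefree_mul_prime p d : prime p -> (0 < d)%N ->
  squarefree (p * d) = ~~ (p %| d)%N && squarefree d.
Proof.
move=> pp d0; have p0 := prime_gt0 pp.
have [pd|pd] /= := boolP (p %| d)%N.
  apply/allP => /(_ p); rewrite primesM// primes_prime// inE eqxx => /(_ isT).
  by rewrite lognM// logn_prime// eqxx eqSS -leqn0 leqNgt logn_gt0 mem_primes pp d0 pd.
rewrite /squarefree (perm_all _ (primes_mul_prime pp d0 pd)) /=.
rewrite lognM// logn_prime// eqxx lognE pp d0 (negPf pd) /=.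
apply: eq_in_all => q; rewrite mem_primes => /and3P[pq _ qd].
rewrite lognM// logn_prime//; case: (eqVneq q p) => // E.
by rewrite -E qd in pd.
Qed.


Lemma sqf_prod_mul_prime (A : comPzSemiRingType) (g : nat -> A) p d :
  prime p -> (0 < d)%N -> sqf_prod g (p * d) =
  if (p %| d)%N then 0 else g p * sqf_prod g d.
Proof.
move=> pp d0; rewrite /sqf_prod squarefree_mul_prime//.
have [//|pd] := boolP (p %| d)%N; rewrite /=.
case: ifP => _; last by rewrite mulr0.
by rewrite (perm_big _ (primes_mul_prime pp d0 pd)) big_cons.
Qed.

(** A new prime [p] leaves the squarefree divisors unchanged when it already
    divides [n]; otherwise it adds their multiples by [p], which contributes the
    factor [1 + g p]. *)
Lemma sqf_prod_sum_divisors (A : comPzSemiRingType) (g : nat -> A) n : (0 < n)%N ->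
  \sum_(d <- divisors n) sqf_prod g d = \prod_(p <- primes n) (1 + g p).
Proof.
elim/prime_mul_ind: n / => [|p n pp n0 IH]; first by rewrite big_seq1 big_nil sqf_prod1.
have p0 := prime_gt0 pp; have pn0 : (0 < p * n)%N by rewrite muln_gt0 p0.
rewrite (bigID (fun d => d %| n)%N) /= -big_filter.
have -> : \sum_(d <- [seq d <- divisors (p * n) | (d %| n)%N]) sqf_prod g d =
          \sum_(d <- divisors n) sqf_prod g d.
  apply/perm_big/uniq_perm; rewrite ?filter_uniq ?divisors_uniq// => d.
  rewrite mem_filter -!dvdn_divisors//.
  by case: (boolP (d %| n)%N) => //= ?; rewrite dvdn_mull.
rewrite IH; have [pn|pn] := boolP (p %| n)%N.
  rewrite (primes_mul_dvd pp) // [X in _ + X]big_seq_cond [X in _ + X]big1 ?addr0// => d /andP[].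
  rewrite -dvdn_divisors// => dpn dn.
  have d0 : (0 < d)%N by apply: dvdn_gt0 dpn.
  have [/dvdnP[e E]|pd] := boolP (p %| d)%N; last first.
    by move: dpn dn; rewrite Gauss_dvdr 1?coprime_sym ?prime_coprime// => ->.
  move: d0 dpn dn; rewrite E mulnC muln_gt0 => /andP[_ e0].
  rewrite dvdn_pmul2l// => en pen; rewrite sqf_prod_mul_prime//; case: ifP => // pe.
  case/negP: pen; rewrite Gauss_dvd ?en ?pn// prime_coprime//.
  by rewrite pe.
rewrite -[X in _ + X]big_filter [X in _ + X](perm_big [seq (p * e)%N | e <- divisors n]); last first.
  apply: uniq_perm; first by rewrite filter_uniq// divisors_uniq.
    rewrite map_inj_in_uniq ?divisors_uniq// => a b _ _ /eqP.
    by rewrite eqn_pmul2l// => /eqP.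
  move=> d; rewrite mem_filter -dvdn_divisors//; apply/idP/mapP.
    case/andP => dn dpn; have [/dvdnP[e E]|pd] := boolP (p %| d)%N; last first.
      by move: dpn dn; rewrite Gauss_dvdr 1?coprime_sym ?prime_coprime// => ->.
    exists e; last by rewrite E mulnC.
    by rewrite -dvdn_divisors//; move: dpn; rewrite E mulnC dvdn_pmul2l.
  case=> e; rewrite -dvdn_divisors// => en ->; rewrite dvdn_pmul2l// en andbT.
  by apply: contra pn; apply: dvdn_trans; apply: dvdn_mulr.
rewrite [X in _ + X]big_map (perm_big _ (primes_mul_prime pp n0 pn)) big_cons /=.
rewrite mulrDl mul1r -IH.
congr (_ + _); rewrite big_distrr /= big_seq [RHS]big_seq; apply: eq_bigr => d.
rewrite -dvdn_divisors// => dn; rewrite sqf_prod_mul_prime ?(dvdn_gt0 _ dn)//.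
case: ifP => // pd; case/negP: pn; exact: dvdn_trans dn.
Qed.

Lemma prod_primes_squarefree d : (0 < d)%N -> squarefree d ->
  (\prod_(p <- primes d) p)%N = d.
Proof.
move=> d0 /allP sf; rewrite [RHS]prod_prime_decomp// prime_decompE big_map /=.
by rewrite big_seq [RHS]big_seq; apply: eq_bigr => p /sf /eqP ->; rewrite expn1.
Qed.

Lemma sqf_prod_div (F : fieldType) (g : nat -> F) d : (0 < d)%N ->
  sqf_prod (fun p => g p / p%:R) d = sqf_prod g d / d%:R.
Proof.
move=> d0; rewrite /sqf_prod; case: ifP => [sf|]; last by rewrite mul0r.
rewrite big_split /= prodfV; congr (_ / _).
by rewrite -natr_prod prod_primes_squarefree.
Qed.

Lemma norm_sqf_prod_le (F : numDomainType) (g h : nat -> F) d :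
  (forall p, prime p -> `|g p| <= h p) -> `|sqf_prod g d| <= sqf_prod h d.
Proof.
move=> gh; rewrite /sqf_prod; case: ifP => _; last by rewrite normr0.
rewrite normr_prod big_seq [leRHS]big_seq; apply: ler_prod => p.
by rewrite mem_primes => /andP[pp _]; rewrite normr_ge0 gh.
Qed.

Lemma sqf_prod_ge0 (F : numDomainType) (g : nat -> F) d :
  (forall p, prime p -> 0 <= g p) -> 0 <= sqf_prod g d.
Proof.
move=> g0; rewrite /sqf_prod; case: ifP => // _; rewrite big_seq.
by apply: prodr_ge0 => p; rewrite mem_primes => /andP[pp _]; exact: g0.
Qed.

Lemma sqf_prod0 (A : comNzSemiRingType) d : (0 < d)%N ->
  sqf_prod (fun=> 0 : A) d = (d == 1%N)%:R.
Proof.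
elim/prime_mul_ind: d / => [|p d pp d0 _]; first by rewrite sqf_prod1.
rewrite sqf_prod_mul_prime// mul0r if_same.
by rewrite muln_eq1 (gtn_eqF (prime_gt1 pp)).
Qed.

(** * Sums over divisors *)

(** A range of summation that does not vary with [n], so that sums over [n] and over
    its divisors can be exchanged. *)
Lemma big_divisors (A : nmodType) (F : nat -> A) n N : (0 < n <= N)%N ->
  \sum_(d <- divisors n) F d = \sum_(1 <= d < N.+1 | (d %| n)%N) F d.
Proof.
case/andP=> n0 nN; rewrite -[RHS]big_filter; apply/perm_big/uniq_perm.
- exact: divisors_uniq.
- by rewrite filter_uniq// iota_uniq.
move=> d; rewrite -dvdn_divisors// mem_filter mem_index_iota.
case: (boolP (d %| n)%N) => //= dn; rewrite (dvdn_gt0 n0 dn) /= ltnS.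
by rewrite (leq_trans (dvdn_leq n0 dn)).
Qed.

Lemma big_multiples (A : nmodType) (F : nat -> A) d N : (0 < d)%N ->
  \sum_(1 <= n < N.+1 | (d %| n)%N) F n = \sum_(1 <= e < (N %/ d).+1) F (d * e)%N.
Proof.
move=> d0; rewrite -[LHS]big_filter -(big_map (muln d) xpredT F).
apply/perm_big/uniq_perm.
- by rewrite filter_uniq// iota_uniq.
- rewrite map_inj_in_uniq ?iota_uniq// => a b _ _ /eqP.
  by rewrite eqn_pmul2l// => /eqP.
move=> n; rewrite mem_filter mem_index_iota; apply/idP/mapP.
  case/and3P=> /dvdnP[e ->] e0 eN; exists e; last by rewrite mulnC.
  rewrite ltnS in eN; rewrite mem_index_iota ltnS leq_divRL// eN andbT.
  by move: e0; rewrite muln_gt0 => /andP[].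
case=> e; rewrite mem_index_iota ltnS leq_divRL// => /andP[e0 eN] ->.
by rewrite dvdn_mulr//= muln_gt0 d0 e0 mulnC ltnS.
Qed.

Lemma sum_divisors_swap (A : nmodType) (F : nat -> nat -> A) N :
  \sum_(1 <= n < N.+1) \sum_(d <- divisors n) F d (n %/ d)%N =
  \sum_(1 <= d < N.+1) \sum_(1 <= e < (N %/ d).+1) F d e.
Proof.
under eq_big_nat => n nN do rewrite (big_divisors _ nN).
rewrite (exchange_big_dep_nat predT)//=; apply: eq_big_nat => d /andP[d0 _].
rewrite big_multiples//; apply: eq_big_nat => e _; by rewrite mulKn.
Qed.

(** Since [mu ^ 2 * (m + 1) ^ omega] is at most the Dirichlet convolution of
    [mu ^ 2 * m ^ omega] with [1], its Dirichlet polynomial for a completely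
    multiplicative weight is at most a product of the two Dirichlet polynomials.
    This replaces the divisor function of order [m] by an induction on [m]. *)
Lemma sum_sqf_prod_le (F : numDomainType) (m : nat) (w : nat -> F) M :
  (forall n, 0 <= w n) -> w 1%N = 1 -> (forall a b, w (a * b)%N = w a * w b) ->
  \sum_(1 <= n < M.+1) sqf_prod (fun=> m%:R) n * w n <=
  (\sum_(1 <= n < M.+1) w n) ^+ m.
Proof.
move=> w0 w1 wM; elim: m => [|m IH].
  rewrite expr0 (_ : \sum_(1 <= n < M.+1) _ = (0 < M)%:R) ?lern1 ?leq_b1//.
  case: M => [|M]; first by rewrite big_geq.
  rewrite big_ltn// sqf_prod1 w1 mulr1 big1_seq ?addr0// => n.
  rewrite /= mem_index_iota => /andP[n1 _].
  by rewrite sqf_prod0 ?(ltnW n1)// gtn_eqF// mul0r.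
have H0 d : 0 <= sqf_prod (fun=> m%:R : F) d.
  by rewrite /sqf_prod; case: ifP => // _; apply: prodr_ge0.
apply: (@le_trans _ _ (\sum_(1 <= n < M.+1) \sum_(d <- divisors n)
    (sqf_prod (fun=> m%:R) d * w d) * w (n %/ d)%N)).
  apply: ler_sum_nat => n /andP[n0 _].
  rewrite (_ : \sum_(d <- _) _ = \prod_(p <- primes n) (1 + m%:R) * w n).
    rewrite ler_wpM2r// /sqf_prod; case: ifP => _.
      by under eq_bigr do rewrite -natr1 addrC.
    by rewrite prodr_ge0// => p _; rewrite addr_ge0.
  rewrite -sqf_prod_sum_divisors// big_distrl /= big_seq [RHS]big_seq.
  apply: eq_bigr => d; rewrite -dvdn_divisors// => dn.
  by rewrite -mulrA -wM mulnC divnK.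
rewrite (sum_divisors_swap (fun d e => sqf_prod (fun=> m%:R) d * w d * w e)).
rewrite exprSr; apply: le_trans (ler_wpM2r _ IH); last exact: sumr_ge0.
rewrite big_distrl /=; apply: ler_sum_nat => d _.
rewrite -big_distrr ler_wpM2l ?mulr_ge0//.
rewrite [leRHS](@big_cat_nat _ _ _ (M %/ d).+1)//= ?ltnS ?leq_div//.
by rewrite lerDl sumr_ge0.
Qed.
(** * Counting admissible tuples *)

Definition admissible (k n : nat) (s : 'I_k -> nat) : bool :=
  coprime (\prod_(i < k) s i) n && coprime (\sum_(i < k) s i) n.

(** The residue classes are represented by 1, ..., n, so that [b] stands for the class
    of [b + 1]; this matches the tuples counted by [phi_k] entry by entry. *)
Definition residue_count (k n : nat) : nat :=
  #|[set b : k.-tuple 'I_n | admissible n (fun i => (tnth b i).+1)]%SET|.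

Lemma phi_k_residue_count k n : (0 < n)%N -> phi_k k n = residue_count k n.
Proof.
case: n => // n _; rewrite /residue_count.
rewrite -(card_imset _ (f := fun b : k.-tuple 'I_n.+1 => map_tuple (lift ord0) b)).
  rewrite /phi_k; apply: eq_card => a; rewrite inE.
  apply/and3P/imsetP => [[/forallP a0 ca sa]|[b bS ->]].
    have a_pred i : ((tnth a i).-1 < n.+1)%N.
      by have := ltn_ord (tnth a i); have := a0 i; lia.
    exists (map_tuple (fun x : 'I_n.+2 => inord x.-1) a); last first.
      apply: eq_from_tnth => i; rewrite !tnth_map; apply: val_inj => /=.
      by rewrite inordK ?a_pred// /bump /= add1n prednK.
    rewrite inE; apply/andP; split.
      rewrite (eq_bigr (fun i => val (tnth a i))) // => i _.
      by rewrite tnth_map inordK ?a_pred// prednK.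
    rewrite (eq_bigr (fun i => val (tnth a i))) // => i _.
    by rewrite tnth_map inordK ?a_pred// prednK.
  move: bS; rewrite inE => /andP[pb sb]; split.
  - by apply/forallP => i; rewrite tnth_map.
  - by under eq_bigr => i _ do rewrite tnth_map lift0.
  - by under eq_bigr => i _ do rewrite tnth_map lift0.
move=> b c /(congr1 val) /= /inj_map H; apply/val_inj/H; exact: lift_inj.
Qed.

Lemma admissible_mod k n (s t : 'I_k -> nat) :
  (forall i, s i = t i %[mod n]) -> admissible n s = admissible n t.
Proof.
move=> st; rewrite /admissible -coprime_modl -[coprime (\sum_i _) _]coprime_modl.
have -> : \prod_(i < k) s i = \prod_(i < k) t i %[mod n].
  by elim/big_ind2: _ => // x1 x2 y1 y2 hx hy; rewrite -modnMm hx hy modnMm.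
have -> : \sum_(i < k) s i = \sum_(i < k) t i %[mod n].
  by elim/big_ind2: _ => // x1 x2 y1 y2 hx hy; rewrite -modnDm hx hy modnDm.
by rewrite !coprime_modl.
Qed.

Lemma admissibleM k m n (s : 'I_k -> nat) :
  admissible (m * n) s = admissible m s && admissible n s.
Proof. by rewrite /admissible !coprimeMr andbACA. Qed.

Lemma admissible_dvd k m n (s : 'I_k -> nat) :
  (m %| n)%N -> admissible n s -> admissible m s.
Proof.
by move=> mn /andP[a b]; rewrite /admissible (coprime_dvdr mn a) (coprime_dvdr mn b).
Qed.

(** An injection of ['I_(p * m)] into ['I_p * 'I_m] is a bijection, and so is the map
    that it induces on tuples. Applied with the two residues when [p] and [m] are
    coprime, and with the quotient and the residue when [p] divides [m]. *)
Lemma card_tuple_fibers k p m n (u : 'I_n -> 'I_p) (v : 'I_n -> 'I_m)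
    (A : {set k.-tuple 'I_p}) (B : {set k.-tuple 'I_m}) :
  n = (p * m)%N -> (forall x y, u x = u y -> v x = v y -> x = y) ->
  #|[set b : k.-tuple 'I_n | (map_tuple u b \in A) && (map_tuple v b \in B)]%SET| =
  (#|A| * #|B|)%N.
Proof.
move=> nE uv; pose f (b : k.-tuple 'I_n) := (map_tuple u b, map_tuple v b).
have f_inj : injective f.
  move=> b c fbc; apply: eq_from_tnth => i; apply: uv.
    by have := congr1 (fun t => tnth t.1 i) fbc; rewrite /= !tnth_map.
  by have := congr1 (fun t => tnth t.2 i) fbc; rewrite /= !tnth_map.
have f_bij : bijective f.
  by apply: inj_card_bij => //; rewrite card_prod !card_tuple !card_ord nE expnMn.
rewrite -cardsX -(on_card_preimset (f := f)); last exact: onW_bij.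
by apply: eq_card => b; rewrite !inE.
Qed.

Lemma residue_count1 k : residue_count k 1 = 1%N.
Proof.
rewrite /residue_count (_ : [set _ | _]%SET = [set: k.-tuple 'I_1]%SET).
  by rewrite cardsT card_tuple card_ord exp1n.
by apply/setP => b; rewrite !inE /admissible !coprimen1.
Qed.

Lemma residue_count_coprime k p m : (0 < p)%N -> (0 < m)%N -> coprime p m ->
  residue_count k (p * m) = (residue_count k p * residue_count k m)%N.
Proof.
move=> p0 m0 pm.
pose u (x : 'I_(p * m)) := Ordinal (ltn_pmod x p0).
pose v (x : 'I_(p * m)) := Ordinal (ltn_pmod x m0).
rewrite -(card_tuple_fibers (u := u) (v := v))//.
  apply: eq_card => b; rewrite !inE admissibleM; congr (_ && _).
    apply: admissible_mod => i; rewrite tnth_map /= -addn1 -modnDml.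
    by rewrite modnDml addn1 -addn1 -[in RHS]addn1 modnDml.
  by apply: admissible_mod => i; rewrite tnth_map /= -addn1 -[in RHS]addn1 modnDml.
move=> x y /(congr1 val)/= xp /(congr1 val)/= xm; apply: val_inj => /=.
apply/eqP; rewrite -(modn_small (ltn_ord x)) -[X in _ == X](modn_small (ltn_ord y)).
by rewrite chinese_remainder// xp xm !eqxx.
Qed.

(** When [p] divides [m], admissibility only depends on the residues modulo [m], and
    each tuple of residues modulo [m] has [p ^ k] lifts. *)
Lemma residue_count_dvd k p m : (0 < p)%N -> (0 < m)%N -> (p %| m)%N ->
  residue_count k (p * m) = (p ^ k * residue_count k m)%N.
Proof.
move=> p0 m0 pm.
have lt_div (x : 'I_(p * m)) : (x %/ m < p)%N by rewrite ltn_divLR.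
pose u (x : 'I_(p * m)) := Ordinal (lt_div x).
pose v (x : 'I_(p * m)) := Ordinal (ltn_pmod x m0).
have <- : #|[set: k.-tuple 'I_p]%SET| = (p ^ k)%N by rewrite cardsT card_tuple card_ord.
rewrite -(card_tuple_fibers (u := u) (v := v))//.
  apply: eq_card => b; rewrite !inE admissibleM andb_idl; last exact: admissible_dvd.
  by apply: admissible_mod => i; rewrite tnth_map /= -addn1 -[in RHS]addn1 modnDml.
move=> x y /(congr1 val)/= xp /(congr1 val)/= xm; apply: val_inj => /=.
by rewrite (divn_eq x m) xp xm -divn_eq.
Qed.

Lemma big_tuple_cons (A : nmodType) (T : finType) k (F : k.+1.-tuple T -> A) :
  \sum_b F b = \sum_(t : k.-tuple T) \sum_x F (cons_tuple x t).
Proof.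
rewrite pair_big /=; apply: (reindex (fun tx => cons_tuple tx.2 tx.1)).
exists (fun b => (behead_tuple b, thead b)) => [[t x] _|b _] /=.
  by congr (_, _); apply: val_inj.
by case/tupleP: b => x t; apply: val_inj; rewrite /= theadE.
Qed.

Lemma coprime0_prime p : prime p -> coprime 0 p = false.
Proof. by move=> pp; rewrite /coprime gcd0n (gtn_eqF (prime_gt1 pp)). Qed.

(** The nonzero residues [x] with [x + s] nonzero are all but the classes of [0] and
    [- s], which coincide exactly when [p] divides [s]. *)
Lemma card_coprime_shift p s : prime p ->
  (\sum_(x < p) (coprime x.+1 p && coprime (x.+1 + s) p) + coprime s p = p.-1)%N.
Proof.
move=> pp; have p0 := prime_gt0 pp.
(* y.+1 and z.+1 represent the classes of - s and 0 *)
have ps_lt : (p.-1 - s %% p < p)%N by lia.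
pose y : 'I_p := Ordinal ps_lt.
have last_lt : (p.-1 < p)%N by lia.
pose z : 'I_p := Ordinal last_lt.
have cE x : coprime x p = ~~ (p %| x)%N by rewrite coprime_sym prime_coprime.
have dz (x : 'I_p) : (p %| x.+1)%N = (x == z).
  apply/idP/eqP => [/dvdn_leq px|->]; last by rewrite /= prednK.
  by apply: val_inj => /=; have := ltn_ord x; have := px isT; lia.
have y_dvd : (p %| y.+1 + s)%N.
  have -> : (y.+1 + s = p + s %/ p * p)%N.
    by rewrite /= {2}(divn_eq s p); have := ltn_pmod s p0; lia.
  by rewrite dvdn_addl ?dvdn_mull.
have dy (x : 'I_p) : (p %| x.+1 + s)%N = (x == y).
  apply/idP/eqP => [px|-> //]; apply: val_inj.
  have : x.+1 + s == y.+1 + s %[mod p] by rewrite (eqP px) (eqP y_dvd).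
  by rewrite eqn_modDr -(addn1 x) -(addn1 y) eqn_modDr !modn_small// => /eqP.
have yz : (p %| s)%N = (y == z).
  apply/idP/eqP => [/eqP ps|/(congr1 val) /= E].
    by apply: val_inj; rewrite /= ps subn0.
  by apply/eqP; have := ltn_pmod s p0; lia.
under eq_bigr => x _ do rewrite !cE dz dy -negb_or.
rewrite cE yz.
rewrite (_ : (\sum_(x < p) _)%N = #|~: [set z; y]%SET|).
  have := cardsC [set z; y]%SET; rewrite cards2 card_ord [z == y]eq_sym.
  by case: (y == z) => /=; lia.
rewrite -sum1_card [RHS]big_mkcond /=; apply: eq_bigr => x _.
by rewrite !inE; case: (_ || _).
Qed.

Lemma residue_countE k n : residue_count k n =
  (\sum_(b : k.-tuple 'I_n) admissible n (fun i => (tnth b i).+1))%N.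
Proof.
by rewrite /residue_count -sum1dep_card [LHS]big_mkcond; apply: eq_bigr => b _; case: ifP.
Qed.

Lemma sum_coprime_tuples k p : prime p ->
  (\sum_(b : k.-tuple 'I_p) coprime (\prod_(i < k) (tnth b i).+1)%N p = p.-1 ^ k)%N.
Proof.
move=> pp; elim: k => [|k IH].
  rewrite (eq_bigr (fun=> 1%N)); last by move=> b _; rewrite big_ord0 coprime1n.
  by rewrite sum1_card card_tuple.
rewrite big_tuple_cons expnSr -IH big_distrl /=; apply: eq_bigr => t _.
rewrite -(card_coprime_shift 0 pp) (coprime0_prime pp) addn0.
rewrite big_distrr /=; apply: eq_bigr => x _.
rewrite addn0 andbb big_ord_recl tnth0 coprimeMl andbC mulnb; congr (nat_of_bool (_ && _)).
by congr coprime; apply: eq_bigr => i _; rewrite tnthS.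
Qed.

Lemma residue_count0 p : prime p -> residue_count 0 p = 0%N.
Proof.
move=> pp; rewrite residue_countE big1// => b _.
by rewrite /admissible !big_ord0 (coprime0_prime pp) andbF.
Qed.

(** A tuple of [k] nonzero residues extends in [p - 1] ways to an admissible tuple if
    its sum vanishes, and in [p - 2] ways otherwise. *)
Lemma residue_count_recl k p : prime p ->
  (residue_count k.+1 p + residue_count k p = p.-1 ^ k.+1)%N.
Proof.
move=> pp; rewrite !residue_countE big_tuple_cons -big_split /=.
rewrite expnSr -(sum_coprime_tuples k pp) big_distrl /=; apply: eq_bigr => t _.
rewrite -(card_coprime_shift (\sum_(i < k) (tnth t i).+1) pp) mulnDr mulnb.
congr (_ + _)%N; rewrite big_distrr /=; apply: eq_bigr => x _; rewrite mulnb.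
rewrite /admissible !big_ord_recl !tnth0 coprimeMl.
have tailE i : (tnth (cons_tuple x t) (lift ord0 i)).+1 = (tnth t i).+1.
  by rewrite tnthS.
rewrite (eq_bigr _ (fun i _ => tailE i)) [X in (_ + X)%N](eq_bigr _ (fun i _ => tailE i)).
by rewrite andbCA andbA.
Qed.

(** The proportion of admissible [k]-tuples modulo the prime [p], which solves the
    recursion of [residue_count_recl]; see [residue_count_prime]. *)
Definition local_density (R : fieldType) (k p : nat) : R :=
  (1 - 1 / p%:R) * ((p%:R - 1) ^+ k - (-1) ^+ k) / p%:R ^+ k.

Lemma residue_count_prime (R : numFieldType) k p : prime p ->
  (residue_count k p)%:R = p%:R ^+ k * local_density R k p.
Proof.
move=> pp; have p0 : p%:R != 0 :> R by rewrite pnatr_eq0 -lt0n prime_gt0.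
rewrite /local_density mulrC divfK ?expf_neq0//.
elim: k => [|k IH]; first by rewrite residue_count0// !expr0 subrr mulr0.
have := residue_count_recl k pp => /(congr1 (fun n => n%:R : R)).
rewrite natrD natrX IH -subn1 natrB ?prime_gt0// => /eqP.
rewrite -subr_eq0 => /eqP H; apply/eqP; rewrite -subr_eq0; apply/eqP; rewrite -H !exprS.
by field.
Qed.

(** A tuple fails to be admissible modulo [p] only through one of [k + 1] conditions,
    each of probability [1 / p]. The lower bound on the density is obtained from the
    recursion on [k] and Bernoulli's inequality. *)
Lemma norm_local_density_sub1 (R : realFieldType) k p : (0 < k)%N -> prime p ->
  `|local_density R k p - 1| <= k.+1%:R / p%:R.
Proof.
move=> k0 pp; have p0 : 0 < p%:R :> R by rewrite ltr0n prime_gt0.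
have le_pk j : (residue_count j p)%:R <= p%:R ^+ j :> R.
  rewrite -natrX ler_nat; apply: leq_trans (max_card _) _.
  by rewrite card_tuple card_ord.
have E j : local_density R j p = (residue_count j p)%:R / p%:R ^+ j.
  by rewrite residue_count_prime// mulrC mulKf// expf_neq0// gt_eqF.
rewrite ler0_norm ?E ?subr_le0 ?ler_pdivrMr ?exprn_gt0 ?mul1r//.
rewrite opprB lerBlDr -lerBlDl.
rewrite ler_pdivlMr ?exprn_gt0//.
case: k k0 => // k _.
have := residue_count_recl k pp => /(congr1 (fun n => n%:R : R)).
rewrite natrD natrX => /(canRL (addrK _)) ->.
apply: le_trans (lerB (lexx _) (le_pk k)).
rewrite -subn1 natrB ?prime_gt0//.
have B : forall n, p%:R ^+ n.+1 - n.+1%:R * p%:R ^+ n <= (p%:R - 1) ^+ n.+1 :> R.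
  elim => [|n IH]; first by rewrite !expr1 expr0; lra.
  have p1 : 0 <= p%:R - 1 :> R by rewrite subr_ge0 ler1n prime_gt0.
  rewrite [leRHS]exprSr; apply: le_trans (ler_wpM2r p1 IH).
  rewrite !exprSr -!natr1; have := exprn_ge0 n (ltW p0).
  have := ler0n R n; set q := p%:R; set w := q ^+ n; set nn := n%:R => h1 h2.
  have : 0 <= (nn + 1) * w by rewrite mulr_ge0// addr_ge0.
  lra.
apply: le_trans (lerB (B k) (lexx _)); rewrite exprSr -natr1 le_eqVlt; apply/orP; left.
by apply/eqP; field; rewrite gt_eqF.
Qed.

Lemma phi_kE (R : numFieldType) k n : (0 < n)%N ->
  (phi_k k n)%:R = n%:R ^+ k * \prod_(p <- primes n) local_density R k p.
Proof.
move=> n0; rewrite phi_k_residue_count//.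
elim/prime_mul_ind: n / n0 => [|p m pp m0 IH].
  by rewrite residue_count1 big_nil expr1n mulr1.
have p0 := prime_gt0 pp; have [pm|pm] := boolP (p %| m)%N.
  by rewrite residue_count_dvd// primes_mul_dvd// natrM IH natrX natrM exprMn mulrA.
rewrite residue_count_coprime ?prime_coprime// natrM IH residue_count_prime//.
rewrite (perm_big _ (primes_mul_prime pp m0 pm)) big_cons natrM exprMn.
by rewrite mulrACA.
Qed.
(** * Sums of powers and partial zeta sums *)

Lemma subrX_bounds (R : numDomainType) k (a b : R) : 0 <= b -> b <= a ->
  k.+1%:R * b ^+ k * (a - b) <= a ^+ k.+1 - b ^+ k.+1 <=
  k.+1%:R * a ^+ k * (a - b).
Proof.
move=> b0 ba; have a0 := le_trans b0 ba.
have ab0 : 0 <= a - b by rewrite subr_ge0.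
rewrite subrXX [X in _ <= X <= _]mulrC; apply/andP; split; apply: ler_wpM2r => //.
  rewrite mulr_natl -[X in _ *+ X]card_ord -sumr_const; apply: ler_sum => i _ /=.
  rewrite -[X in _ ^+ X <= _](subnK (ltnSE (ltn_ord i))) exprD.
  by rewrite ler_wpM2r ?exprn_ge0// lerXn2r.
rewrite mulr_natl -[X in _ *+ X]card_ord -sumr_const; apply: ler_sum => i _ /=.
rewrite -[X in _ <= _ ^+ X](subnK (ltnSE (ltn_ord i))) exprD.
by rewrite ler_wpM2l ?exprn_ge0// lerXn2r.
Qed.

Lemma sum_powers_bounds (R : numDomainType) k N :
  (N%:R : R) ^+ k.+1 <= k.+1%:R * \sum_(1 <= e < N.+1) (e%:R : R) ^+ k <=
  (N%:R : R) ^+ k.+1 + k.+1%:R * (N%:R : R) ^+ k.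
Proof.
elim: N => [|N /andP[IHl IHu]].
  by rewrite big_geq// mulr0 expr0n/= lexx add0r mulr_ge0// exprn_ge0.
have leN : N%:R <= N.+1%:R :> R by rewrite ler_nat.
have /andP[dl du] := subrX_bounds k (ler0n R N) leN.
rewrite -[N.+1%:R]natr1 [N%:R + 1 - _]addrAC subrr add0r !mulr1 in dl du.
rewrite big_nat_recr//= -[N.+1%:R]natr1 mulrDr; apply/andP; split.
  by rewrite -lerBlDr (le_trans _ IHl)// lerBlDr -lerBlDl.
by rewrite lerD2r (le_trans IHu)// addrC -lerBrDr.
Qed.

(** Both [\sum_(e <= N) e ^ k] and [y ^ (k + 1) / (k + 1)] exceed [N ^ (k + 1) / (k + 1)]
    by at most [y ^ k]. *)
Lemma sum_powers_approx (R : realFieldType) k N (y : R) : N%:R <= y -> y <= N.+1%:R ->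
  `|\sum_(1 <= e < N.+1) e%:R ^+ k - y ^+ k.+1 / k.+1%:R| <= y ^+ k.
Proof.
move=> Ny yN; have N0 : 0 <= N%:R :> R by [].
have y0 := le_trans N0 Ny; have k0 : 0 < k.+1%:R :> R by rewrite ltr0n.
have /andP[lo up] := sum_powers_bounds R k N.
have /andP[_ du] := subrX_bounds k N0 Ny.
rewrite -(ler_pM2l k0) -[X in X * `|_|]gtr0_norm// -normrM mulrBr mulrCA divff ?gt_eqF// mulr1.
have yk0 : 0 <= k.+1%:R * y ^+ k by rewrite mulr_ge0 ?exprn_ge0// ltW.
have Nyk : k.+1%:R * N%:R ^+ k <= k.+1%:R * y ^+ k by rewrite ler_pM2l// lerXn2r.
have Nyk1 : N%:R ^+ k.+1 <= y ^+ k.+1 by rewrite lerXn2r.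
have gap : y ^+ k.+1 - N%:R ^+ k.+1 <= k.+1%:R * y ^+ k.
  by apply: le_trans du _; rewrite ler_piMr// lerBlDl natr1.
rewrite ler_norml; apply/andP; split; lra.
Qed.

(** The sum telescopes against [(1 - M ^ (- e)) / e], which plays the role of the
    integral of [t ^ (- (1 + e))]. *)
Lemma zeta_partial_sum_le (R : realType) (e : R) M : 0 < e ->
  \sum_(1 <= n < M.+1) n%:R `^ (- (1 + e)) <= 1 + e^-1.
Proof.
move=> e0; case: M => [|M]; first by rewrite big_geq// addr_ge0// invr_ge0 ltW.
suff : \sum_(1 <= n < M.+2) n%:R `^ (- (1 + e)) <= 1 + (1 - M.+1%:R `^ (- e)) / e.
  move/le_trans; apply; rewrite lerD2l mulrBl mul1r gerBl.
  by rewrite divr_ge0 ?powR_ge0// ltW.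
elim: M => [|M IH]; first by rewrite big_nat1 !powR1 subrr mul0r addr0.
rewrite big_nat_recr//=; apply: le_trans (lerD IH (lexx _)) _.
rewrite -addrA lerD2l -lerBrDl -mulrBl opprB [X in _ <= X / _]addrC addrA subrK.
rewrite ler_pdivlMr//.
have n0 : 0 < M.+2%:R :> R by rewrite ltr0n.
have m0 : 0 < M.+1%:R :> R by rewrite ltr0n.
rewrite opprD powRD ?(gt_eqF n0) ?implybT// powR_inv1 ?(ltW n0)//.
(* with u = 1 / (M + 2): (1 - u) ^ (- e) >= 1 - e * ln (1 - u) >= 1 + e * u *)
have key : 1 + e / M.+2%:R <= (M.+1%:R / M.+2%:R) `^ (- e).
  have q0 : 0 < M.+1%:R / M.+2%:R :> R by rewrite divr_gt0.
  rewrite /powR (gt_eqF q0); apply: le_trans (expR_ge1Dx _).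
  rewrite lerD2l mulNr -mulrN ler_pM2l// lerNr.
  have -> : M.+1%:R / M.+2%:R = 1 + (- M.+2%:R^-1) :> R.
    have n_neq0 := lt0r_neq0 n0.
    apply: (mulIf n_neq0).
    by rewrite divfK// mulrDl mul1r mulNr mulVf// -[M.+2%:R]natr1 addrK.
  by rewrite le_ln1Dx// ltrN2 invf_lt1// ltr1n.
have E : M.+1%:R `^ (- e) = (M.+1%:R / M.+2%:R) `^ (- e) * M.+2%:R `^ (- e).
  by rewrite -powRM ?divfK ?gt_eqF// ?divr_ge0// ltW.
rewrite E -[X in _ - X]mul1r -mulrBl mulrAC ler_wpM2r ?powR_ge0//.
by rewrite mulrC lerBrDl.
Qed.
(** * Rankin's trick *)

Lemma rankin_sum (R : realType) (m : nat) (e : R) M : 0 < e ->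
  \sum_(1 <= d < M.+1) sqf_prod (fun=> m%:R) d / d%:R * d%:R `^ (- e) <=
  (1 + e^-1) ^+ m.
Proof.
move=> e0; pose w (n : nat) : R := n%:R `^ (- (1 + e)).
have w0 n : 0 <= w n by exact: powR_ge0.
have w1 : w 1%N = 1 by rewrite /w powR1.
have wM a b : w (a * b)%N = w a * w b by rewrite /w natrM powRM.
apply: (@le_trans _ _ (\sum_(1 <= d < M.+1) sqf_prod (fun=> m%:R) d * w d)).
  rewrite le_eqVlt; apply/orP; left; apply/eqP; apply: eq_big_nat => d /andP[d0 _].
  have d_neq0 : d%:R != 0 :> R by rewrite pnatr_eq0 -lt0n.
  by rewrite -mulrA /w opprD powRD ?d_neq0 ?implybT// powR_inv1.
apply: le_trans (sum_sqf_prod_le _ _ _ _ _) _ => //.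
by rewrite lerXn2r ?nnegrE ?sumr_ge0 ?addr_ge0 ?invr_ge0 ?(ltW e0)// zeta_partial_sum_le.
Qed.

Lemma norm_sqf_prod_le_div (R : realType) (m : nat) (g : nat -> R) d :
  (forall p, prime p -> `|g p| <= m%:R / p%:R) -> (0 < d)%N ->
  `|sqf_prod g d| <= sqf_prod (fun=> m%:R) d / d%:R.
Proof. by move=> g_le d0; rewrite -sqf_prod_div//; exact: norm_sqf_prod_le. Qed.

(** Rankin's trick: for [d <= x] the factor [(x / d) ^ e] is at least 1. *)
Lemma sum_norm_sqf_prod_le (R : realType) (m : nat) (g : nat -> R) (x e : R) M :
  (forall p, prime p -> `|g p| <= m%:R / p%:R) -> 0 < x -> 0 < e ->
  \sum_(1 <= d < M.+1 | d%:R <= x) `|sqf_prod g d| <= x `^ e * (1 + e^-1) ^+ m.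
Proof.
move=> g_le x0 e0; apply: le_trans (ler_wpM2l (powR_ge0 _ _) (rankin_sum m M e0)).
rewrite big_distrr /= [leLHS]big_mkcond /=; apply: ler_sum_nat => d /andP[d0 _].
case: ifP => [dx|_].
  apply: le_trans (norm_sqf_prod_le_div g_le d0) _.
  rewrite mulrCA ler_peMr ?mulr_ge0 ?invr_ge0 ?sqf_prod_ge0//.
  have dR : 0 < d%:R :> R by rewrite ltr0n.
  rewrite powRN ler_pdivlMr ?powR_gt0// mul1r.
  by rewrite ge0_ler_powR// ?nnegrE ltW.
by rewrite !mulr_ge0 ?powR_ge0 ?invr_ge0 ?sqf_prod_ge0.
Qed.

(** Rankin's trick again: for [d >= x] and [e <= 1] one has
    [1 <= (d / x) ^ (1 - e)]. *)
Lemma sum_norm_sqf_prod_tail_le (R : realType) (m : nat) (g : nat -> R) (x e : R) M :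
  (forall p, prime p -> `|g p| <= m%:R / p%:R) -> 0 < x -> 0 < e -> e <= 1 ->
  \sum_(1 <= d < M.+1 | x <= d%:R) `|sqf_prod g d / d%:R| <=
  x `^ e / x * (1 + e^-1) ^+ m.
Proof.
move=> g_le x0 e0 e1; have xe0 : 0 <= x `^ e / x by rewrite divr_ge0 ?powR_ge0 ?ltW.
apply: le_trans (ler_wpM2l xe0 (rankin_sum m M e0)).
rewrite big_distrr /= [leLHS]big_mkcond /=; apply: ler_sum_nat => d /andP[d0 _].
have dm0 : 0 <= sqf_prod (fun=> m%:R) d / d%:R :> R by rewrite mulr_ge0 ?invr_ge0 ?sqf_prod_ge0.
case: ifP => [dx|_]; last by rewrite !mulr_ge0 ?powR_ge0 ?invr_ge0 ?sqf_prod_ge0 ?(ltW x0).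
have dR : 0 < d%:R :> R by rewrite ltr0n.
rewrite normrM [`|d%:R^-1|]gtr0_norm ?invr_gt0//.
apply: le_trans (ler_wpM2r _ (norm_sqf_prod_le_div g_le d0)) _; first by rewrite invr_ge0.
rewrite mulrCA ler_wpM2l//.
have xpow : x `^ e / x = (x `^ (1 - e))^-1.
  by rewrite -powRN opprB powRD ?(gt_eqF x0) ?implybT// powR_inv1// ltW.
have dpow : d%:R^-1 = (d%:R `^ (1 - e))^-1 * d%:R `^ (- e) :> R.
  rewrite -!powRN -powRD ?(gt_eqF dR) ?implybT//.
  by rewrite opprB addrAC subrr add0r powR_inv1.
rewrite xpow dpow ler_wpM2r ?powR_ge0//.
rewrite lef_pV2 ?posrE ?powR_gt0//.
by rewrite ge0_ler_powR ?subr_ge0 ?nnegrE ?(ltW x0) ?(ltW dR).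
Qed.

(** * The Euler product as a sum over squarefree integers *)

Lemma prime_dvd_fact p n : prime p -> (p %| n`!)%N = (p <= n)%N.
Proof.
move=> pp; apply/idP/idP => [|pn]; last by rewrite dvdn_fact// prime_gt0.
elim: n => [|n IH]; first by rewrite fact0 Euclid_dvd1.
rewrite factS Euclid_dvdM// => /orP[/dvdn_leq->//|/IH/leqW//].
Qed.

(** The primes below [M + 1] are those dividing the factorial of [M]. This choice of
    modulus makes every [d <= M] one of the divisors, squarefree or not. *)
Lemma euler_prod_divisors (F : fieldType) (g : nat -> F) M :
  \prod_(0 <= p < M.+1 | prime p) (1 + g p / p%:R) =
  \sum_(d <- divisors M`!) sqf_prod g d / d%:R.
Proof.
transitivity (\sum_(d <- divisors M`!) sqf_prod (fun p => g p / p%:R) d); last first.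
  rewrite big_seq [RHS]big_seq; apply: eq_bigr => d.
  by rewrite -dvdn_divisors ?fact_gt0// => dM; rewrite sqf_prod_div// (dvdn_gt0 _ dM) ?fact_gt0.
rewrite sqf_prod_sum_divisors ?fact_gt0// -big_filter; apply/perm_big/uniq_perm.
- by rewrite filter_uniq// iota_uniq.
- exact: primes_uniq.
move=> p; rewrite mem_filter mem_index_iota mem_primes fact_gt0 /= ltnS.
by case: (boolP (prime p)) => //= pp; rewrite prime_dvd_fact.
Qed.

Lemma sum_divisors_fact_truncate (F : numDomainType) (f : nat -> F) N M : (N <= M)%N ->
  `|\sum_(d <- divisors M`!) f d - \sum_(1 <= d < N.+1) f d| <=
  \sum_(1 <= d < (M`!).+1 | (N < d)%N) `|f d|.
Proof.
move=> NM; have NQ : (N <= M`!)%N := leq_trans NM (fact_geq M).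
rewrite (big_divisors f (N := M`!)) ?fact_gt0 ?leqnn//.
rewrite (bigID (fun d => d <= N)%N) /=.
have -> : \sum_(1 <= d < (M`!).+1 | (d %| M`!)%N && (d <= N)%N) f d =
          \sum_(1 <= d < N.+1) f d.
  rewrite [RHS](big_nat_widen _ _ (M`!).+1)//= big_nat_cond [RHS]big_nat_cond.
  apply: eq_bigl => d; rewrite !ltnS; case: (boolP (d <= N)%N) => [dN|]; rewrite ?andbF//.
  case: (boolP (1 <= d)%N) => //= d0.
  by rewrite dvdn_fact ?d0 ?(leq_trans dN).
rewrite addrAC subrr add0r; apply: le_trans (ler_norm_sum _ _ _) _.
rewrite big_mkcond [leRHS]big_mkcond; apply: ler_sum_nat => d _ /=.
rewrite -ltnNge; case: (boolP (N < d)%N) => _; rewrite ?andbT ?andbF//.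
by case: ifP.
Qed.

Lemma euler_prod_approx (R : realType) (m : nat) (g : nat -> R) (x e : R) M :
  (forall p, prime p -> `|g p| <= m%:R / p%:R) ->
  0 < x -> 0 < e -> e <= 1 -> (Num.truncn x < M)%N ->
  `|\prod_(0 <= p < M | prime p) (1 + g p / p%:R) -
    \sum_(1 <= d < (Num.truncn x).+1) sqf_prod g d / d%:R| <=
  x `^ e / x * (1 + e^-1) ^+ m.
Proof.
move=> g_le x0 e0 e1; case: M => // M; rewrite ltnS => xM.
rewrite euler_prod_divisors; apply: le_trans (sum_divisors_fact_truncate _ xM) _.
apply: le_trans (sum_norm_sqf_prod_tail_le (M`!) g_le x0 e0 e1).
rewrite big_mkcond [leRHS]big_mkcond; apply: ler_sum_nat => d _ /=.
case: ifP => [xd|_]; last by case: ifP.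
by rewrite ifT// ltW// (lt_le_trans (truncnS_gt _))// ler_nat.
Qed.

(** The partial products stay close to the truncated sums of [sqf_prod g d / d]; for the
    Cauchy criterion the exponent [1 / 2] in Rankin's trick is enough. *)
Lemma is_cvg_euler_prod (R : realType) (m : nat) (g : nat -> R) :
  (forall p, prime p -> `|g p| <= m%:R / p%:R) ->
  cvgn (fun M => \prod_(0 <= p < M | prime p) (1 + g p / p%:R)).
Proof.
move=> g_le; apply: cauchy_cvg; apply: cauchy_exP => eps eps0.
(* at x = z ^ 2 and e = 1 / 2 the bound of euler_prod_approx is 3 ^ m / z = eps / 2 *)
pose z : R := 2 * 3 ^+ m / eps.
have z0 : 0 < z by rewrite /z divr_gt0// mulr_gt0// exprn_gt0.
exists (\sum_(1 <= d < (Num.truncn (z ^+ 2)).+1) sqf_prod g d / d%:R).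
exists (Num.truncn (z ^+ 2)).+1 => // M /= zM.
rewrite /ball /= distrC.
have := euler_prod_approx g_le (exprn_gt0 2 z0) (e := 2^-1) _ _ zM.
move=> /(_ ltac:(lra) ltac:(lra)) /le_lt_trans; apply.
have -> : (z ^+ 2) `^ 2^-1 = z.
  by rewrite -powR_mulrn ?(ltW z0)// -powRrM divff// powRr1// ltW.
have m0 : (3 : R) ^+ m != 0 by rewrite expf_neq0.
have -> : z / z ^+ 2 * (1 + 2^-1^-1) ^+ m = eps / 2.
  rewrite invrK (_ : 1 + 2 = 3 :> R); last by ring.
  by rewrite /z; field; rewrite m0 gt_eqF.
lra.
Qed.

Lemma lim_euler_prod_approx (R : realType) (m : nat) (g : nat -> R) (x e : R) :
  (forall p, prime p -> `|g p| <= m%:R / p%:R) ->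
  0 < x -> 0 < e -> e <= 1 ->
  `|limn (fun M => \prod_(0 <= p < M | prime p) (1 + g p / p%:R)) -
    \sum_(1 <= d < (Num.truncn x).+1) sqf_prod g d / d%:R| <=
  x `^ e / x * (1 + e^-1) ^+ m.
Proof.
move=> g_le x0 e0 e1; set s := \sum_(1 <= d < _) _.
have cv := is_cvg_euler_prod g_le.
apply: (cvgr_to_le (f := fun M => `|\prod_(0 <= p < M | prime p) (1 + g p / p%:R) - s|)
  (F := \oo)).
  by apply: cvg_norm; apply: cvgB => //; exact: cvg_cst.
near=> M; apply: euler_prod_approx => //.
by near: M; exact: nbhs_infty_gt.
Unshelve. all: by end_near. Qed.

(** * The summatory function *)

(** Writing [\prod_(p | n) (1 + g p)] as a divisor sum and summing over [n = d * j]
    first in [j] gives [x ^ (k + 1) / (k + 1)] times the sum of [sqf_prod g d / d] over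
    [d <= x], with error at most [x ^ k] times the sum of the [`|sqf_prod g d|].
    Completing the former sum to the Euler product costs its tail. Rankin's trick
    bounds both errors by the same quantity. *)
Lemma sum_twisted_powers_approx (R : realType) (m k : nat) (g : nat -> R) (x e : R) :
  (forall p, prime p -> `|g p| <= m%:R / p%:R) ->
  0 < x -> 0 < e -> e <= 1 ->
  `|\sum_(1 <= n < (Num.truncn x).+1) (n%:R ^+ k * \prod_(p <- primes n) (1 + g p)) -
    limn (fun M => \prod_(0 <= p < M | prime p) (1 + g p / p%:R)) / k.+1%:R * x ^+ k.+1| <=
  2 * (x ^+ k * (x `^ e * (1 + e^-1) ^+ m)).
Proof.
move=> g_le x0 e0 e1; set N := Num.truncn x; set L := limn _.
set B := x `^ e * (1 + e^-1) ^+ m.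
have Nx : N%:R <= x by rewrite truncn_le ltW.
have B0 : 0 <= B by rewrite mulr_ge0 ?powR_ge0// exprn_ge0// addr_ge0// invr_ge0 ltW.
have xk0 : 0 <= x ^+ k by rewrite exprn_ge0// ltW.
have -> : \sum_(1 <= n < N.+1) (n%:R ^+ k * \prod_(p <- primes n) (1 + g p)) =
    \sum_(1 <= d < N.+1) sqf_prod g d * d%:R ^+ k * \sum_(1 <= j < (N %/ d).+1) j%:R ^+ k.
  under [RHS]eq_bigr => d _ do rewrite big_distrr /=.
  rewrite -(sum_divisors_swap (fun d j => sqf_prod g d * d%:R ^+ k * j%:R ^+ k)).
  apply: eq_big_nat => n /andP[n0 _]; rewrite -sqf_prod_sum_divisors// big_distrr /=.
  rewrite big_seq [RHS]big_seq; apply: eq_bigr => d; rewrite -dvdn_divisors// => dn.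
  by rewrite -mulrA -exprMn -natrM mulnC divnK// mulrC.
pose S := \sum_(1 <= d < N.+1) sqf_prod g d / d%:R.
have main : `|\sum_(1 <= d < N.+1) sqf_prod g d * d%:R ^+ k *
      \sum_(1 <= j < (N %/ d).+1) j%:R ^+ k - S / k.+1%:R * x ^+ k.+1| <= x ^+ k * B.
  rewrite /S !big_distrl /= -sumrB.
  apply: le_trans (ler_norm_sum _ _ _) _.
  have := sum_norm_sqf_prod_le N g_le x0 e0; rewrite -/B => /(ler_wpM2l xk0).
  apply: le_trans; rewrite big_distrr /= [leRHS]big_mkcond /=.
  apply: ler_sum_nat => d /andP[d0 dN].
  have dR : 0 < d%:R :> R by rewrite ltr0n.
  rewrite ifT; last by rewrite (le_trans _ Nx)// ler_nat.
  have lo : (N %/ d)%:R <= x / d%:R.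
    by rewrite ler_pdivlMr// -natrM (le_trans _ Nx)// ler_nat leq_divM.
  have hi : x / d%:R <= (N %/ d).+1%:R.
    rewrite ler_pdivrMr// -natrM ltW// (lt_le_trans (truncnS_gt x))// ler_nat.
    by rewrite -/N ltn_ceil.
  have := sum_powers_approx k lo hi.
  set T := \sum_(1 <= j < _) _ => TB.
  have -> : sqf_prod g d * d%:R ^+ k * T - sqf_prod g d / d%:R / k.+1%:R * x ^+ k.+1 =
      sqf_prod g d * d%:R ^+ k * (T - (x / d%:R) ^+ k.+1 / k.+1%:R).
    have d_neq0 := lt0r_neq0 dR.
    rewrite mulrBr exprMn exprVn; congr (_ - _); rewrite [d%:R ^+ k.+1]exprSr invfM.
    rewrite [RHS]mulrA [X in _ = X * _]mulrCA -[RHS]mulrA [LHS]mulrC.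
    by congr (_ * (_ / _)); rewrite mulrA mulfK// expf_neq0.
  rewrite !normrM [`|d%:R ^+ k|]ger0_norm ?exprn_ge0//.
  rewrite -mulrA mulrC ler_wpM2r//.
  apply: le_trans (ler_wpM2l _ TB) _; first by rewrite exprn_ge0.
  by rewrite -exprMn mulrC divfK ?gt_eqF.
have tail : `|S / k.+1%:R * x ^+ k.+1 - L / k.+1%:R * x ^+ k.+1| <= x ^+ k * B.
  have := lim_euler_prod_approx g_le x0 e0 e1; rewrite -/L -/N -/S distrC => LS.
  rewrite -mulrA -[L / _ * _]mulrA -mulrBl normrM.
  have q0 : 0 <= k.+1%:R^-1 * x ^+ k.+1 by rewrite mulr_ge0 ?invr_ge0 ?exprn_ge0 ?(ltW x0).
  rewrite (ger0_norm q0); apply: le_trans (ler_wpM2r q0 LS) _.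
  have -> : x `^ e / x * (1 + e^-1) ^+ m * (k.+1%:R^-1 * x ^+ k.+1) =
      k.+1%:R^-1 * (x ^+ k * B).
    rewrite /B exprS; set E := _ ^+ m; field; rewrite gt_eqF//= ?gt_eqF ?ltr0n//.
  apply: ler_piMl; first exact: mulr_ge0.
  by rewrite invf_le1 ?ltr0n// ler1n.
rewrite mulr_natl mulr2n; apply: le_trans (lerD main tail).
apply: le_trans (ler_normD _ _); by rewrite addrA subrK.
Qed.

(** The choice [e = 1 / ln x] makes [x ^ e] constant and turns [1 + 1 / e] into a
    power of the logarithm. *)
Lemma rankin_exponent (R : realType) (m : nat) (x : R) : expR 1 <= x ->
  x `^ (ln x)^-1 * (1 + (ln x)^-1^-1) ^+ m <= expR 1 * 2 ^+ m * ln x ^+ m.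
Proof.
move=> ex; have x0 : 0 < x := lt_le_trans (expR_gt0 1) ex.
have lx : 1 <= ln x by rewrite -[leLHS]expRK ler_ln// posrE expR_gt0.
have lx0 : 0 < ln x := lt_le_trans ltr01 lx.
rewrite /powR gt_eqF// mulVf ?gt_eqF// invrK -mulrA ler_pM2l ?expR_gt0// -exprMn.
by rewrite lerXn2r ?nnegrE; lra.
Qed.

Lemma euler_factorE (R : realType) k p : prime p ->
  euler_factor R k p = 1 + (local_density R k p - 1) / p%:R.
Proof.
move=> pp; rewrite /euler_factor /local_density exprS.
have p0 : p%:R != 0 :> R by rewrite pnatr_eq0 -lt0n prime_gt0.
by field; rewrite ?p0 ?expf_neq0.
Qed.

Theorem theorem2p2 (R : realType) (k : nat) (hk : (2 <= k)%N) :
  cvgn (euler_partial_prod R k) /\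
  (fun x : R => \sum_(1 <= n < (Num.truncn x).+1) (phi_k k n)%:R : R) =
    (fun x : R => C_ R k / k.+1%:R * x ^+ k.+1)
    +O_ (pinfty_nbhs R) (fun x : R => x ^+ k * ln x ^+ k.+1).
Proof.
have g_le p : prime p -> `|local_density R k p - 1| <= k.+1%:R / p%:R.
  by move=> pp; apply: norm_local_density_sub1 => //; exact: leq_trans hk.
have prodE : euler_partial_prod R k =
    fun M => \prod_(0 <= p < M | prime p) (1 + (local_density R k p - 1) / p%:R).
  by apply/funext => M; apply: eq_bigr => p; exact: euler_factorE.
split; first by rewrite prodE; exact: is_cvg_euler_prod g_le.
apply/eqaddOP.
pose K : R := 2 * (expR 1 * 2 ^+ k.+1).
near=> c; near=> x; rewrite /= fctE.
have ex : expR 1 <= x by near: x; apply: nbhs_pinfty_ge; exact: num_real.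
have Kc : K <= c by near: c; apply: nbhs_pinfty_ge; exact: num_real.
have x0 : 0 < x := lt_le_trans (expR_gt0 1) ex.
have lx : 1 <= ln x by rewrite -[leLHS]expRK ler_ln// posrE expR_gt0.
have lx0 : 0 < ln x := lt_le_trans ltr01 lx.
have xk0 : 0 <= x ^+ k by rewrite exprn_ge0// ltW.
have main0 : 0 <= x ^+ k * ln x ^+ k.+1 by rewrite mulr_ge0// exprn_ge0// ltW.
rewrite (ger0_norm main0); apply: le_trans (ler_wpM2r main0 Kc).
have := @sum_twisted_powers_approx R k.+1 k _ x (ln x)^-1 g_le x0.
rewrite invr_gt0 invf_le1// => /(_ lx0 lx).
rewrite /C_ prodE (eq_big_nat _ _ (F2 := fun n => (phi_k k n)%:R)); last first.
  move=> n /andP[n0 _]; rewrite phi_kE//; congr (_ * _).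
  by apply: eq_bigr => p _; rewrite addrC subrK.
move=> /le_trans; apply.
rewrite /K -mulrA ler_pM2l// [leRHS]mulrCA ler_wpM2l//.
exact: rankin_exponent.
Unshelve. all: by end_near. Qed.
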